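(* Let $\Gamma$ be a weighted directed multigraph with vertex set $V\ni 0$, where $0$ is the root vertex (no arc of $\Gamma$ has target $0$), and with arc set $E=D\cup\{e\}$, where $D$ is a set of arcs and $e$ is an arc with weight $w(e)$, source $s(e)=a$ and target $t(e)=b$, with $a,b\in V$ and $b\neq 0$. Let $c\in V$ and let $\Gamma'$ be the weighted directed multigraph with vertex set $V$ and arc set $E'=D\cup\{e'\}$, where $e'$ has source $c$, target $b$ and weight $w(e')=w(e)$. Suppose that $a$ and $b$ are not strongly connected in $\Gamma$ and that $c$ and $b$ are not strongly connected in $\Gamma'$. Then the sum of arborescence weights of $\Gamma'$ equals the sum of arborescence weights of $\Gamma$.
   Context: An arborescence of a digraph with root vertex $0$ and vertex set $V$ is a set of $|V|-1$ arcs containing no directed cycle, in which vertex $0$ has indegree $0$ and every other vertex has indegree exactly one (a spanning directed tree with all vertices reachable from $0$). Its weight is the product of the weights of its arcs, and the sum of arborescence weights of a digraph is the sum of these weights over all its arborescences. Two vertices $x,y$ are strongly connected in a digraph if there is a directed path from $x$ to $y$ and a directed path from $y$ to $x$. *)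

(* Defs.v *)
From HB Require Import structures.
From mathcomp Require Import all_boot all_order all_algebra.

Set Implicit Arguments.
Unset Strict Implicit.
Unset Printing Implicit Defensive.

Import GRing.Theory.
Local Open Scope ring_scope.

(* Arcs are a type of their own, so parallel arcs and loops are allowed. *)
Record wdigraph (R : Type) (V : finType) := WDigraph {
  arc : finType;
  source : arc -> V;
  target : arc -> V;
  weight : arc -> R
}.

Arguments source {R V} G x : rename.
Arguments target {R V} G x : rename.
Arguments weight {R V} G x : rename.

(* The new arc is [None]; it is always distinct from the arcs of [D]. *)
Definition add_arc (R : Type) (V : finType) (D : wdigraph R V)
    (a b : V) (w : R) : wdigraph R V :=
  @WDigraph R V (option (arc D))
    (oapp (source D) a) (oapp (target D) b) (oapp (weight D) w).

Section Digraph.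
Variables (R : Type) (V : finType) (G : wdigraph R V).
Implicit Types (A : {set arc G}) (p : seq (arc G)).

Definition rooted_at (r : V) : bool := [forall x : arc G, target G x != r].

Definition adjacent : rel V :=
  [rel x y | [exists e : arc G, (source G e == x) && (target G e == y)]].

(* [connect] is reflexive: the path of length 0 counts. *)
Definition strongly_connected (x y : V) : bool :=
  connect adjacent x y && connect adjacent y x.

Definition indegree A (v : V) : nat := #|[set x in A | target G x == v]|.

(* A loop is a directed cycle of length 1. *)
Definition dicycle p : bool :=
  [&& p != [::], cycle [rel x y | target G x == source G y] p
    & uniq (map (source G) p)].

(* The vertices of a directed cycle being distinct, its length is at most
   #|V|; this makes the predicate boolean. See [acyclicP]. *)
Definition acyclic A : bool :=
  [forall n : 'I_#|V|.+1, forall p : n.-tuple (arc G),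
     dicycle p ==> ~~ all [in A] p].

Lemma acyclicP A :
  reflect (forall p, dicycle p -> ~ {subset p <= A}) (acyclic A).
Proof.
apply: (iffP 'forall_forallP) => [acA p cp sub | acA n p].
  have szp : (size p < #|V|.+1)%N.
    case/and3P: cp => _ _ up; rewrite ltnS -(size_map (source G)).
    by rewrite -(card_uniqP up) max_card.
  have /implyP/(_ cp)/negP := acA (Ordinal szp) (in_tuple p).
  by apply; apply/allP.
by apply/implyP => cp; apply/negP => /allP sub; apply: (acA p cp).
Qed.

Definition arborescence (r : V) A : bool :=
  [&& #|A| == #|V|.-1, acyclic A, indegree A r == 0%N
    & [forall v, (v != r) ==> (indegree A v == 1%N)]].

End Digraph.

Definition arborescence_sum (R : comNzRingType) (V : finType)
    (G : wdigraph R V) (r : V) : R :=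
  \sum_(A : {set arc G} | arborescence r A) \prod_(x in A) weight G x.

(* Main.v *)
Require Import Defs.
From HB Require Import structures.
From mathcomp Require Import all_boot all_order all_algebra.

Set Implicit Arguments.
Unset Strict Implicit.
Unset Printing Implicit Defensive.

(** The arcs of the two digraphs are put in bijection by exchanging the two new
    arcs. The new arc lies on no directed cycle, since its ends would then be
    strongly connected. So both digraphs have the same directed cycles, and,
    the targets being the same, the same arborescences. *)

(** Only the arcs of [p] are traversed; [x] and [y] merely mark the two ends. *)
Lemma path_connect (R : Type) (V : finType) (G : wdigraph R V)
    (x y : Defs.arc G) (p : seq (Defs.arc G)) :
  path [rel u v | target G u == source G v] x (rcons p y) ->
  connect (adjacent G) (target G x) (source G y).
Proof.
elim: p x => [|z p IHp] x /=; first by rewrite andbT => /eqP ->.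
case/andP=> /eqP -> /IHp; apply: connect_trans; apply: connect1.
by apply/existsP; exists z; rewrite !eqxx.
Qed.

Lemma dicycle_strongly_connected (R : Type) (V : finType) (G : wdigraph R V)
    (p : seq (Defs.arc G)) (x : Defs.arc G) :
  dicycle p -> x \in p -> strongly_connected G (source G x) (target G x).
Proof.
case/and3P=> _ cp _ /rot_to [i q rp]; apply/andP; split.
  by apply: connect1; apply/existsP; exists x; rewrite !eqxx.
(* Once rotated to start at [x], the cycle leads back from the target of [x] to its source; for a
   loop, [q] is empty. *)
by apply: (@path_connect _ _ G x x q); move: cp; rewrite -(rot_cycle i) rp.
Qed.

Lemma dicycle_add_arc (R : Type) (V : finType) (D : wdigraph R V)
    (a b c : V) (w : R) (p : seq (option (Defs.arc D))) :
  None \notin p ->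
  dicycle (G := add_arc D a b w) p -> dicycle (G := add_arc D c b w) p.
Proof.
move=> pN /and3P [p0 cp up].
have eq_source : {in p, source (add_arc D a b w) =1 source (add_arc D c b w)}.
  by case=> [x|] //= px; rewrite px in pN.
apply/and3P; split=> //; last by move/eq_in_map: eq_source => <-.
(* Targets agree definitionally, so only the source of the later arc [y] must be compared. *)
apply: sub_in_cycle _ (allss p) cp => x y _ py /=.
by move: (eq_source y py) => /= ->.
Qed.

Lemma acyclic_add_arc (R : Type) (V : finType) (D : wdigraph R V)
    (a b c : V) (w : R) (A : {set option (Defs.arc D)}) :
  ~~ strongly_connected (add_arc D a b w) a b ->
  acyclic (G := add_arc D c b w) A -> acyclic (G := add_arc D a b w) A.
Proof.
move=> nab /acyclicP acA; apply/acyclicP => p cp; apply: acA.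
apply: dicycle_add_arc (cp); apply/negP => pN.
by case/negP: nab; exact: dicycle_strongly_connected cp pN.
Qed.

Theorem theorem3 (R : comNzRingType) (V : finType) (r : V)
    (D : wdigraph R V) (a b c : V) (w : R)
    (hb : b != r)
    (hroot : rooted_at (add_arc D a b w) r)
    (hab : ~~ strongly_connected (add_arc D a b w) a b)
    (hcb : ~~ strongly_connected (add_arc D c b w) c b) :
  arborescence_sum (add_arc D c b w) r = arborescence_sum (add_arc D a b w) r.
Proof.
(* Arc type, targets and weights coincide by conversion, hence so do the products, cardinalities and
   indegrees; only acyclicity depends on the sources. *)
apply: eq_bigl => A; congr [&& _, _ & _].
by apply/idP/idP; apply: acyclic_add_arc.
Qed.
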